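(* Let $m,n\ge2$ be integers, let $X=\{1,\dots,m\}\times\{1,\dots,n\}$, let $\mathcal P=\{C_1,\dots,C_m\}$ with $C_i=\{i\}\times\{1,\dots,n\}$, and let $S=\langle E(\mathcal T(X,\mathcal P))\rangle$. Let $\rho_2=2$ and $\rho_n=\binom n2$ if $n\ge3$. Let $U_1,\dots,U_m$ be minimal idempotent generating sets of $\mathcal E_n$. Let $V\subseteq E(\mathcal D_m)$ be such that $\mathcal T_m\setminus\mathcal S_m=\langle V\rangle_{\mathrm{sgp}}$; for each $(i,j)\in\Xi_V$ choose an ordered pair $(A_{ij},B_{ij})$ of non-empty subsets of $\mathcal S_n$ such that $\mathcal S_n$ is the disjoint union $A_{ij}\sqcup B_{ij}$, and put $$W=\bigcup_{(i,j)\in\Phi_V}\{e_{ij;f}:f\in\mathcal S_n\}\ \cup\bigcup_{(i,j)\in\Xi_V}\Big(\{e_{ij;f}:f\in A_{ij}\}\cup\{e_{ji;f^{-1}}:f\in B_{ij}\}\Big).$$ Then $U_1^{(1)}\cup\cdots\cup U_m^{(m)}\cup W$ is an idempotent generating set of the monoid $S$ of size $m\rho_n+n!\binom m2$. Consequently, $$\mathrm{rank}(S)=\mathrm{idrank}(S)=m\rho_n+n!\binom m2.$$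
   Context: Maps are written on the right of their arguments and composed from left to right. $\mathcal T_k$ is the monoid of all functions $\{1,\dots,k\}\to\{1,\dots,k\}$, $\mathcal S_k$ is the symmetric group, and $\mathcal E_k$ is the submonoid of $\mathcal T_k$ generated by its idempotents. $E(M)$ denotes the set of idempotents of $M$; $\langle U\rangle$ and $\langle U\rangle_{\mathrm{sgp}}$ denote the submonoid and subsemigroup generated by $U$. For a monoid $M$, $\mathrm{rank}(M)$ is the least size of a subset $U\subseteq M$ with $\langle U\rangle=M$; if $M$ is idempotent generated, $\mathrm{idrank}(M)$ is the least size of a subset $U\subseteq E(M)$ with $\langle U\rangle=M$. An idempotent generating set of $M$ is a set $U\subseteq E(M)$ with $\langle U\rangle=M$; it is minimal if it has the smallest possible size among idempotent generating sets. $\mathcal T(X,\mathcal P)$ is the monoid of all functions $f:X\to X$ such that for every $i$ there is a $j$ with $C_if\subseteq C_j$. Each $f\in\mathcal T(X,\mathcal P)$ is uniquely written $f=[f_1,\dots,f_m;\overline f]$ with $\overline f\in\mathcal T_m$ and $f_1,\dots,f_m\in\mathcal T_n$, where $(i,j)f=(i\overline f,jf_i)$; the product is $fg=[f_1g_{1\overline f},\dots,f_mg_{m\overline f};\overline f\,\overline g]$. For $g\in\mathcal T_n$ and $i\in\{1,\dots,m\}$, $g^{(i)}=[1,\dots,1,g,1,\dots,1;1]$ with $g$ in the $i$th position, and $U^{(i)}=\{g^{(i)}:g\in U\}$ for $U\subseteq\mathcal T_n$. $\mathcal D_m=\{f\in\mathcal T_m:|\mathrm{im}(f)|=m-1\}$,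 and $E(\mathcal D_m)=\{e_{ij}:i,j\in\{1,\dots,m\},\ i\ne j\}$ is the set of idempotents in $\mathcal D_m$, where $e_{ij}$ maps $j$ to $i$ and fixes every other point. For distinct $i,j\in\{1,\dots,m\}$ and $f\in\mathcal S_n$, $e_{ij;f}=[1,\dots,1,f,1,\dots,1;e_{ij}]$ with $f$ in the $j$th position. For $V\subseteq E(\mathcal D_m)$: $\Xi_V=\{(i,j):1\le i<j\le m,\ e_{ij}\in V\text{ and }e_{ji}\in V\}$ and $\Phi_V=\{(i,j):i,j\in\{1,\dots,m\},\ i\ne j,\ e_{ij}\in V\text{ but }e_{ji}\notin V\}$. *)

(* Defs.v *)
From HB Require Import structures.
From mathcomp Require Import all_boot all_fingroup.

Set Implicit Arguments.
Unset Strict Implicit.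
Unset Printing Implicit Defensive.

Local Open Scope group_scope.

(* Maps act on the right: f * g applies f first. *)
Definition trans (T : finType) := {ffun T -> T}.

HB.instance Definition _ (T : finType) := Finite.on (trans T).

Section TransMonoid.
Variable T : finType.

Definition trans_mul (f g : trans T) : trans T := [ffun x => g (f x)].
Definition trans_one : trans T := [ffun x => x].

Lemma trans_mulA : associative trans_mul.
Proof. by move=> f g h; apply/ffunP=> x; rewrite !ffunE. Qed.

Lemma trans_mul1 : left_id trans_one trans_mul.
Proof. by move=> f; apply/ffunP=> x; rewrite !ffunE. Qed.

Lemma trans_mulr1 : right_id trans_one trans_mul.
Proof. by move=> f; apply/ffunP=> x; rewrite !ffunE. Qed.

HB.instance Definition _ :=
  isMonoid.Build (trans T) trans_mulA trans_mul1 trans_mulr1.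

End TransMonoid.

Section Generation.
Variable T : finType.
Implicit Types U M : {set trans T}.

Definition is_subsemigroup M : bool :=
  [forall f in M, forall g in M, f * g \in M].

Definition is_submonoid M : bool := (1 \in M) && is_subsemigroup M.

Definition sgp_gen U : {set trans T} :=
  \bigcap_(M : {set trans T} | is_subsemigroup M && (U \subset M)) M.

Definition mon_gen U : {set trans T} :=
  \bigcap_(M : {set trans T} | is_submonoid M && (U \subset M)) M.

Definition idems M : {set trans T} := [set f in M | f * f == f].

Definition genset M U : bool := (U \subset M) && (mon_gen U == M).

Definition idgenset M U : bool := (U \subset idems M) && (mon_gen U == M).

(* The [arg min] default M is a generating set whenever M is a submonoid. *)
Definition rank M : nat := #|[arg min_(U < M | genset M U) #|U|]|.

(* The [arg min] default [idems M] is an idempotent generating set whenever M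
   is an idempotent generated submonoid. *)
Definition idrank M : nat := #|[arg min_(U < idems M | idgenset M U) #|U|]|.

Definition min_idgenset M U : Prop :=
  idgenset M U /\ forall U' : {set trans T}, idgenset M U' -> #|U| <= #|U'|.

Definition trans_of_perm (s : {perm T}) : trans T := [ffun x => s x].

Definition sym : {set trans T} := [set trans_of_perm s | s : {perm T}].

End Generation.

(* Points are numbered from 0: {1,...,k} is 'I_k. *)
Definition idgen_trans (k : nat) : {set trans 'I_k} := mon_gen (idems setT).

Definition sing_trans (k : nat) : {set trans 'I_k} := ~: sym 'I_k.

Definition defect1 (k : nat) : {set trans 'I_k} :=
  [set f : trans 'I_k | #|f @: [set: 'I_k]| == k.-1].

Definition e_ (m : nat) (i j : 'I_m) : trans 'I_m :=
  [ffun k => if k == j then i else k].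

Definition rho (n : nat) : nat := if n == 2 then 2 else 'C(n, 2).

Section Uniform.
Variables m n : nat.

Definition block (i : 'I_m) : {set 'I_m * 'I_n} := [set x | x.1 == i].

Definition TXP : {set trans ('I_m * 'I_n)%type} :=
  [set f : trans ('I_m * 'I_n)%type |
    [forall i, exists j, f @: block i \subset block j]].

(* [f_1, ..., f_m; fbar] *)
Definition wreath (F : 'I_m -> trans 'I_n) (fbar : trans 'I_m) :
    trans ('I_m * 'I_n)%type :=
  [ffun x => (fbar x.1, F x.1 x.2)].

(* g^(i) *)
Definition at_block (i : 'I_m) (g : trans 'I_n) : trans ('I_m * 'I_n)%type :=
  wreath (fun k => if k == i then g else 1) 1.

(* e_{ij;f} *)
Definition e_perm (i j : 'I_m) (f : 'S_n) : trans ('I_m * 'I_n)%type :=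
  wreath (fun k => if k == j then trans_of_perm f else 1) (e_ i j).

Definition Xi (V : {set trans 'I_m}) : {set 'I_m * 'I_m} :=
  [set p : 'I_m * 'I_m |
    [&& p.1 < p.2, e_ p.1 p.2 \in V & e_ p.2 p.1 \in V]].

Definition Phi (V : {set trans 'I_m}) : {set 'I_m * 'I_m} :=
  [set p : 'I_m * 'I_m |
    [&& p.1 != p.2, e_ p.1 p.2 \in V & e_ p.2 p.1 \notin V]].

Definition Wset (V : {set trans 'I_m}) (A B : 'I_m -> 'I_m -> {set 'S_n}) :
    {set trans ('I_m * 'I_n)%type} :=
  (\bigcup_(p in Phi V) [set e_perm p.1 p.2 f | f : 'S_n]) :|:
  (\bigcup_(p in Xi V)
     ([set e_perm p.1 p.2 f | f in A p.1 p.2] :|: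
      [set e_perm p.2 p.1 f^-1 | f in B p.1 p.2])).

End Uniform.

(* Main.v *)
Require Import Defs.
From mathcomp Require Import all_boot all_fingroup.

Set Implicit Arguments.
Unset Strict Implicit.
Unset Printing Implicit Defensive.

(* Generation: a singular transformation is a product of maps e_ij, by moving nonfixed values into
   the point missed by its image. The maps [h_1^-1 h_{1 al}, ..., h_m^-1 h_{m al}; al] compose as
   the maps al do, so those generated by W are all obtained from the labelled e_ij with e_ij in V;
   for a pair in Xi both label sets are recovered by taking powers of e_{ij;f} e_{ji;g}. Every
   idempotent of T(X, P) is one such map between two products of elements acting within blocks.

   Lower bound: S has no unit but 1, so the first factor u of e_{ij;f}, or of e_ab^(i), collapses
   some pair of points that the product collapses; as u preserves the blocks, it then has the same
   kernel as the product. These kernels are pairwise distinct, and for n = 2 each of the two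
   constants in a block is irreducible. This bound also gives the size of the generating set,
   which is at most the same number because E_n is generated by rho_n idempotents e_ij, those of a
   strongly connected tournament when n >= 3. *)

(** * Generated submonoids, their factorizations and their units *)

Section Gen.
Local Open Scope group_scope.
Variable T : finType.
Implicit Types (M U : {set trans T}) (x y : trans T).

Lemma trans_mulE x y p : (x * y) p = y (x p).
Proof. by rewrite ffunE. Qed.

Lemma trans_oneE p : (1 : trans T) p = p.
Proof. by rewrite ffunE. Qed.

Lemma subsemigroupP M :
  reflect (forall x y, x \in M -> y \in M -> x * y \in M) (is_subsemigroup M).
Proof.
apply: (iffP forall_inP) => [h x y xM yM | h x xM].
  by have /forall_inP/(_ y yM) := h x xM.
by apply/forall_inP => y yM; apply: h.
Qed.

Lemma submonoidP M :
  reflect (1 \in M /\ forall x y, x \in M -> y \in M -> x * y \in M)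
          (is_submonoid M).
Proof.
by apply: (iffP andP) => [[h /subsemigroupP] | [h /subsemigroupP]].
Qed.

Lemma mon_gen_submonoid U : is_submonoid (mon_gen U).
Proof.
apply/submonoidP; split.
  by apply/bigcapP => M /andP[/submonoidP[]].
move=> x y /bigcapP xM /bigcapP yM; apply/bigcapP => M hM.
by have /andP[/submonoidP[_ h] _] := hM; apply: h; [apply: xM | apply: yM].
Qed.

Lemma mon_gen1 U : 1 \in mon_gen U.
Proof. by have /submonoidP[] := mon_gen_submonoid U. Qed.

Lemma mon_genM U x y : x \in mon_gen U -> y \in mon_gen U -> x * y \in mon_gen U.
Proof. by have /submonoidP[_] := mon_gen_submonoid U; apply. Qed.

Lemma sub_mon_gen U : U \subset mon_gen U.
Proof. by apply/bigcapsP => M /andP[]. Qed.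

Lemma mem_mon_gen U x : x \in U -> x \in mon_gen U.
Proof. exact: (subsetP (sub_mon_gen U)). Qed.

Lemma mon_gen_subset U M : is_submonoid M -> U \subset M -> mon_gen U \subset M.
Proof. by move=> hM hU; apply: bigcap_inf; rewrite hM. Qed.

Lemma sgp_gen_subset U M :
  is_subsemigroup M -> U \subset M -> sgp_gen U \subset M.
Proof. by move=> hM hU; apply: bigcap_inf; rewrite hM. Qed.

Lemma mon_gen_id M : is_submonoid M -> mon_gen M = M.
Proof.
by move=> hM; apply/eqP; rewrite eqEsubset sub_mon_gen mon_gen_subset.
Qed.

Lemma genset_mon_gen U : genset (mon_gen U) (mon_gen U).
Proof. by rewrite /genset subxx (mon_gen_id (mon_gen_submonoid U)) eqxx. Qed.

Lemma idgenset_genset M U : idgenset M U -> genset M U.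
Proof.
case/andP => h1 h2; rewrite /genset h2 andbT.
by apply: subset_trans h1 _; apply/subsetP => x; rewrite inE => /andP[].
Qed.

Lemma idgenset_idems M : idgenset (mon_gen (idems M)) (idems (mon_gen (idems M))).
Proof.
rewrite /idgenset subxx eqEsubset mon_gen_subset ?mon_gen_submonoid //=; last first.
  by apply/subsetP => x; rewrite inE => /andP[].
apply: mon_gen_subset; first exact: mon_gen_submonoid.
apply/subsetP => x hx; apply: mem_mon_gen; rewrite inE mem_mon_gen //=.
by move: hx; rewrite inE => /andP[].
Qed.

Lemma idgensetE M U :
  U \subset idems M -> idems M \subset mon_gen U ->
  idgenset (mon_gen (idems M)) U.
Proof.
move=> hU hM; have hUS : U \subset mon_gen (idems M).
  exact: subset_trans hU (sub_mon_gen _).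
apply/andP; split.
  apply/subsetP => x xU; rewrite inE (subsetP hUS) //=.
  by have := subsetP hU x xU; rewrite inE => /andP[].
by rewrite eqEsubset !mon_gen_subset ?mon_gen_submonoid.
Qed.

Lemma rank_genset M U : genset M U -> rank M <= #|U|.
Proof.
rewrite /rank => hU; case: arg_minnP => [|U' _ h]; last exact: h.
have /andP[_ /eqP <-] := hU; exact: genset_mon_gen.
Qed.

Lemma trans_inj_mulr x y : injective (x * y) -> injective x.
Proof. by move=> h p q e; apply: h; rewrite !trans_mulE e. Qed.

Lemma idem_inj x : x * x = x -> injective x -> x = 1.
Proof.
move=> xx xI; apply/ffunP => p; rewrite trans_oneE; apply: xI.
by rewrite -trans_mulE xx.
Qed.

(** An injective product has an injective first factor, and an injective idempotent is 1; so the
    property defining [N] passes from idempotents to products. *)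
Lemma mon_gen_idems_inj M x : x \in mon_gen (idems M) -> injective x -> x = 1.
Proof.
pose N := [set x : trans T | injectiveb x ==> (x == 1)].
have hN : is_submonoid N.
  apply/submonoidP; split => [|{}x y]; first by rewrite inE eqxx implybT.
  rewrite !inE => /implyP hx /implyP hy; apply/implyP => /injectiveP xyI.
  have x1 : x = 1 by apply/eqP/hx/injectiveP; apply: trans_inj_mulr xyI.
  by rewrite x1 mul1g hy //; move: xyI; rewrite x1 mul1g => /injectiveP.
have /subsetP h : mon_gen (idems M) \subset N.
  apply: (mon_gen_subset hN); apply/subsetP => {}x; rewrite !inE => /andP[_ /eqP xx].
  by apply/implyP => /injectiveP /(idem_inj xx) ->.
by move=> /h; rewrite inE => /implyP hx /injectiveP /hx /eqP.
Qed.

Lemma mon_gen_factor U x :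
  x \in mon_gen U -> x != 1 ->
  exists u v, [/\ u \in U, u != 1, v \in mon_gen U & x = u * v].
Proof.
pose N := [set x in mon_gen U | (x == 1) ||
  [exists u in U, exists v in mon_gen U, (u != 1) && (x == u * v)]].
have hN : is_submonoid N.
  apply/submonoidP; split=> [|{}x y]; first by rewrite inE mon_gen1 eqxx.
  rewrite [x \in N]inE => /andP[xG] /orP[/eqP->|]; first by rewrite mul1g.
  case/exists_inP=> u uU /exists_inP[v vG /andP[u1 /eqP->]].
  rewrite !inE => /andP[yG _]; rewrite mon_genM //; last first.
    by rewrite mon_genM // mem_mon_gen.
  apply/orP; right; apply/exists_inP; exists u => //.
  by apply/exists_inP; exists (v * y); rewrite ?mon_genM // u1 mulgA eqxx.
have /subsetP h : mon_gen U \subset N.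
  apply: (mon_gen_subset hN); apply/subsetP => u uU; rewrite inE mem_mon_gen //=.
  case: eqVneq => //= u1; apply/exists_inP; exists u => //.
  by apply/exists_inP; exists 1; rewrite ?mon_gen1 // u1 mulg1 /=.
move=> /h; rewrite inE => /andP[_] /orP[-> //|].
by case/exists_inP=> u uU /exists_inP[v vG /andP[u1 /eqP->]] _; exists u, v.
Qed.

Lemma mem_sym x : (x \in sym T) = injectiveb x.
Proof.
apply/imsetP/injectiveP => [[s _ ->] p q|xI].
  by rewrite !ffunE => /perm_inj.
by exists (perm xI) => //; apply/ffunP => p; rewrite !ffunE permE.
Qed.

Lemma trans_of_permM (s t : {perm T}) :
  trans_of_perm (s * t) = trans_of_perm s * trans_of_perm t.
Proof. by apply/ffunP => p; rewrite !ffunE permM. Qed.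

Lemma trans_of_perm1 : trans_of_perm (1 : {perm T}) = 1.
Proof. by apply/ffunP => p; rewrite !ffunE perm1. Qed.

Lemma trans_surj x : (forall c, exists p, x p = c) -> injective x.
Proof.
move=> h; have h' c : exists p, x p == c by have [p <-] := h c; exists p.
have xK : cancel (fun c => xchoose (h' c)) x.
  by move=> c; apply/eqP; apply: xchooseP (h' c).
exact: can_inj (canF_sym xK).
Qed.

End Gen.

Lemma mon_gen_hom (T T' : finType) (phi : trans T -> trans T') (U : {set trans T})
    (H : {set trans T'}) :
  is_submonoid H -> phi 1%g = 1%g ->
  (forall x y, phi (x * y)%g = (phi x * phi y)%g) ->
  (forall u, u \in U -> phi u \in H) ->
  forall x, x \in mon_gen U -> phi x \in H.
Proof.
move=> /submonoidP[H1 HM] phi1 phiM hU x xU.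
have : x \in phi @^-1: H.
  apply: (subsetP _ _ xU); apply: mon_gen_subset; last first.
    by apply/subsetP => u /hU; rewrite inE.
  apply/submonoidP; split=> [|y z]; rewrite !inE ?phi1 // phiM; exact: HM.
by rewrite inE.
Qed.

(** * Singular transformations as products of the idempotents [e_ i j] *)

Section Howie.
Local Open Scope group_scope.
Variable k : nat.
Implicit Types (i j c d p q : 'I_k) (x y : trans 'I_k) (M : {set trans 'I_k}).

Lemma e_E i j p : e_ i j p = if p == j then i else p.
Proof. by rewrite ffunE. Qed.

Lemma e_same i j : e_ i j i = i.
Proof. by rewrite e_E; case: eqP. Qed.

Lemma e_idem i j : e_ i j * e_ i j = e_ i j.
Proof.
apply/ffunP => p; rewrite trans_mulE [e_ i j p]e_E.
by case: (p =P j) => [_|/eqP pj]; rewrite ?e_same // e_E (negPf pj).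
Qed.

(** On a finite set, not injective means not surjective; the missed point [c] is the hole into which
    values are moved below. *)
Lemma sing_transP x : reflect (exists c, forall p, x p != c) (x \in sing_trans k).
Proof.
rewrite inE mem_sym; apply: (iffP idP) => [|[c hc]].
  have [/existsP[c /forallP hc] _|/existsPn h] := boolP [exists c, [forall p, x p != c]].
    by exists c.
  case/negP; apply/injectiveP/trans_surj => c; have /forallPn[p] := h c.
  by rewrite negbK => /eqP; exists p.
apply/injectiveP => xI; have [y _ yK] := injF_bij xI.
by have := hc (y c); rewrite yK eqxx.
Qed.

Lemma e_sing i j : i != j -> e_ i j \in sing_trans k.
Proof.
by move=> ij; apply/sing_transP; exists j => p; rewrite e_E; case: (p =P j) => // /eqP.
Qed.

(* If c is missed by x, the slide e_ c d, which moves the value d to c, is undone by e_ d c. *)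
Lemma slideK x c d : (forall p, x p != c) -> x * e_ c d * e_ d c = x.
Proof.
move=> hc; apply/ffunP => p; rewrite !trans_mulE !e_E.
by case: (x p =P d) => [->|_]; rewrite ?eqxx // (negPf (hc p)).
Qed.

Lemma slide_hole x c d : c != d -> forall p, (x * e_ c d) p != d.
Proof. by move=> cd p; rewrite trans_mulE e_E; case: (x p =P d) => // /eqP. Qed.

(** Induction on the number of moved points: [x] is a single [e_ d c], or it factors into maps [e_]
    and a singular map that keeps the fixed points of [x] and fixes one more. *)
Lemma sing_trans_sub M :
  is_subsemigroup M -> (forall i j, i != j -> e_ i j \in M) ->
  sing_trans k \subset M.
Proof.
move=> /subsemigroupP MM eM; apply/subsetP => x.
pose N x := #|[pred p | x p != p]|.
have [r] := ubnP (N x); elim: r x => // r IH x; rewrite ltnS => hr sx.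
have {}IH y : y \in sing_trans k -> (N y < N x)%N -> y \in M.
  by move=> sy yx; apply: IH => //; apply: leq_trans yx hr.
have {}IH y p0 : y \in sing_trans k -> x p0 != p0 -> y p0 = p0 ->
    (forall p, x p = p -> y p = p) -> y \in M.
  move=> sy xp0 yp0 yx; apply: IH => //; apply: proper_card; apply/properP; split.
    by apply/subsetP => p; rewrite !inE; apply: contraNneq => /yx ->.
  by exists p0; rewrite inE // yp0 eqxx.
have /sing_transP[c hc] := sx.
have dc : x c != c := hc c; set d := x c in dc.
have cd : c != d by rewrite eq_sym.
(* If [d] is moved, sliding the value [d] into the hole [c] makes [c] fixed, and [d] was no fixed
   point to lose. *)
have [xd|xd] := eqVneq (x d) d; last first.
  rewrite -(slideK d hc); apply: MM; last exact: eM.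
  apply: (IH _ c) => //.
  - by apply/sing_transP; exists d; apply: slide_hole.
  - by rewrite trans_mulE -/d e_E eqxx.
  - by move=> p xp; rewrite trans_mulE xp e_E; case: eqP => // pd; rewrite -pd xp eqxx in xd.
have [/exists_inP[p pc /andP[xp /eqP xxp]]|hfix] :=
  boolP [exists p in predC1 c, (x p != p) && (x (x p) == x p)].
  (* p and x p have the same value, so the value at p is free after composing with
     e_ (x p) p: change it to p. *)
  pose y : trans 'I_k := [ffun q => if q == p then p else x q].
  have -> : x = e_ (x p) p * y.
    apply/ffunP => q; rewrite trans_mulE e_E [RHS]ffunE.
    by case: (q =P p) => [->|/eqP/negPf->//]; rewrite (negPf xp) xxp.
  apply: MM; first exact: eM.
  apply: (IH _ p) => //.
  - apply/sing_transP; exists c => q; by rewrite ffunE; case: ifP.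
  - by rewrite [y p]ffunE eqxx.
  - by move=> q xq; rewrite [y q]ffunE; case: eqP.
have {}hfix p : p != c -> x p != p -> x (x p) != x p.
  by move=> pc xp; have /exists_inPn/(_ p pc) := hfix; rewrite xp.
(* If [c] is the only moved point, [x] is [e_ d c]. *)
have [/existsP[y /andP[yc xy]]|/existsPn hid] :=
  boolP [exists p, (p != c) && (x p != p)]; last first.
  have -> : x = e_ d c; last exact: eM.
  apply/ffunP => p; rewrite e_E; case: eqP => [->//|/eqP pc].
  by have := hid p; rewrite pc negbK => /eqP.
(* Every nonfixed point other than c is sent to a nonfixed point, so no point fixed by x is
   the image of y or of x y; sliding x y to c and then x (x y) to x y fixes x y. *)
pose t := x y; pose z := x t.
have tc : t != c := hc y.
have zt : z != t := hfix y yc xy.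
have tz : t != z by rewrite eq_sym.
have ct : c != t by rewrite eq_sym.
have xz : x z != z := hfix t tc zt.
rewrite -(slideK t hc) -(slideK z (slide_hole x ct)).
apply: (MM _ _ _ (eM _ _ _)) => //.
apply: (MM _ _ _ (eM _ _ _)) => //.
apply: (IH _ t) => //.
- by apply/sing_transP; exists z; apply: slide_hole.
- rewrite !trans_mulE -/z !e_E (negPf zt) eqxx //.
- move=> p xp; rewrite !trans_mulE xp !e_E.
  case: (p =P t) => [pt|_]; first by move: zt; rewrite /z -pt xp eqxx.
  case: (p =P z) => // pz; by rewrite -pz xp eqxx in xz.
Qed.
End Howie.

(** * Small idempotent generating sets of E_n *)

Section Tournament.
Local Open Scope group_scope.
Variable k : nat.
Implicit Types (i j c d p q a b : 'I_k) (x y : trans 'I_k) (M : {set trans 'I_k}).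

(* After e_ b a merges a into b, the hole a travels once around the triangle, and then on to b. *)
Lemma e_triangle a b c : a != b -> b != c -> c != a ->
  e_ a b = e_ b a * e_ a c * e_ c b * e_ b a * e_ a c * e_ c b.
Proof.
move=> ab bc ca; apply/ffunP => p; rewrite !trans_mulE !e_E.
have hE := (eqxx, negPf ab, negPf bc, negPf ca, eq_sym b a, eq_sym c b, eq_sym a c).
have [->|/negPf pa] := eqVneq p a; first by do 8! rewrite ?hE //=.
have [->|/negPf pb] := eqVneq p b; first by do 8! rewrite ?hE //=.
have [->|/negPf pc] := eqVneq p c; first by do 8! rewrite ?hE //=.
by rewrite !(pa, pb, pc).
Qed.

Lemma submonoid_sgp M : is_submonoid M -> is_subsemigroup M.
Proof. by case/andP. Qed.

Lemma idems_sing : idems [set: trans 'I_k] \subset [set (1 : trans 'I_k)] :|: sing_trans k.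
Proof.
apply/subsetP => x; rewrite !inE mem_sym => /= /eqP xx.
by case: injectiveP => [xI|]; rewrite ?orbT // (idem_inj xx xI) eqxx.
Qed.

Lemma sub_idgen_trans M : is_submonoid M -> (forall i j, i != j -> e_ i j \in M) ->
  idgen_trans k \subset M.
Proof.
move=> hM eM; apply: mon_gen_subset => //; apply: subset_trans idems_sing _.
rewrite subUset sub1set; case/submonoidP: (hM) => -> _ /=.
by apply: sing_trans_sub => //; apply: submonoid_sgp.
Qed.

Lemma sing_idgen_trans : sing_trans k \subset idgen_trans k.
Proof.
apply: sing_trans_sub => [|i j _]; first exact/submonoid_sgp/mon_gen_submonoid.
by apply: mem_mon_gen; rewrite !inE e_idem eqxx.
Qed.

Lemma card_ltn_pairs : #|[set p : 'I_k * 'I_k | p.1 < p.2]| = 'C(k, 2).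
Proof.
rewrite -sum1dep_card (eq_bigl (fun p : 'I_k * 'I_k => p.1 < p.2)) //.
rewrite -bin2_sum big_mkord.
rewrite (eq_bigr (fun j : 'I_k => \sum_(i < k | i < j) 1)); last first.
  by move=> j _; rewrite -(big_ord_widen k (fun=> 1%N)) ?sum1_card ?card_ord // ltnW.
rewrite (exchange_big_dep predT) //= pair_big_dep /=.
by apply: eq_bigl.
Qed.

End Tournament.

(** For n >= 3, take the transitive tournament of the [e_ i j] with i < j and reverse its arc
    between the first and the last point. By [e_triangle], the arcs of a directed 3-cycle generate
    the reverse of each of them. *)
Lemma idgen_trans_small n : 2 <= n ->
  exists U, idgenset (idgen_trans n) U /\ #|U| <= rho n.
Proof.
rewrite leq_eqVlt => /orP[/eqP <-|].
  exists [set @e_ 2 ord0 ord_max; @e_ 2 ord_max ord0]; split; last first.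
    by rewrite cards2; case: eqP.
  apply: idgensetE.
    by apply/subsetP => x; rewrite !inE => /orP[] /eqP->; rewrite e_idem eqxx.
  apply: subset_trans (sub_mon_gen _) _; apply: sub_idgen_trans.
    exact: mon_gen_submonoid.
  move=> i j ij; apply: mem_mon_gen; rewrite !inE.
  case: i j ij => [[|[|//]] hi] [[|[|//]] hj] //= _; apply/orP; [left|right];
  by apply/eqP; congr e_; apply: val_inj.
case: n => [//|n n2].
pose arc (i j : 'I_n.+1) := if (i == ord0) && (j == ord_max) then e_ j i else e_ i j.
exists [set arc p.1 p.2 | p in [set p : 'I_n.+1 * 'I_n.+1 | p.1 < p.2]]; split; last first.
  apply: leq_trans (leq_imset_card _ _) _; rewrite card_ltn_pairs /rho.
  by case: eqP n2 => // ->.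
set U := [set _ | p in _].
have hU (i j : 'I_n.+1) : (i < j)%N -> ~~ ((i == ord0) && (j == ord_max)) -> e_ i j \in mon_gen U.
  move=> ij h; apply: mem_mon_gen; apply/imsetP; exists (i, j); rewrite ?inE //=.
  by rewrite /arc (negPf h).
have hM0 : e_ ord_max ord0 \in mon_gen U.
  apply: mem_mon_gen; apply/imsetP; exists (ord0, ord_max); rewrite ?inE /= ?/arc ?eqxx //.
  exact: (@ltnW 1).
have tri (a b c : 'I_n.+1) : a != b -> b != c -> c != a -> e_ b a \in mon_gen U ->
    e_ a c \in mon_gen U -> e_ c b \in mon_gen U -> e_ a b \in mon_gen U.
  by move=> ab bc ca *; rewrite (e_triangle ab bc ca) !mon_genM.
have ltn_neq (i j : 'I_n.+1) : (i < j)%N -> (i != j) * (j != i).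
  by move=> ij; rewrite -!val_eqE neq_ltn ij eq_sym neq_ltn ij.
(* The arc from the first to the last point is recovered through the point 1; then each [e_ j ord0]
   through the last point, and finally every other [e_ j i] with i < j through the first point. *)
have ltU (i j : 'I_n.+1) : (i < j)%N -> e_ i j \in mon_gen U.
  move=> ij; have [/andP[/eqP-> /eqP->]|] := boolP ((i == ord0) && (j == ord_max)); last exact: hU.
  pose one : 'I_n.+1 := inord 1; have oneE : one = 1%N :> nat by rewrite inordK // ltnW.
  have lt01 : (@ord0 n < one)%N by rewrite oneE.
  have lt1M : (one < @ord_max n)%N by rewrite oneE.
  have lt0M := ltn_trans lt01 lt1M.
  have e1 := ltn_neq _ _ lt01; have e2 := ltn_neq _ _ lt1M; have e3 := ltn_neq _ _ lt0M.
  by apply: (tri _ _ one); rewrite ?e1 ?e2 ?e3 //; apply: hU; rewrite // ?e1 ?e2 ?negb_and ?e1 ?e2 ?orbT.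
have geU0 (j : 'I_n.+1) : j != ord0 -> e_ j ord0 \in mon_gen U.
  move=> j0; have [->//|jM] := eqVneq j ord_max.
  have lt0j : (@ord0 n < j)%N by rewrite lt0n.
  have ltjM : (j < @ord_max n)%N by rewrite ltn_neqAle jM /= -ltnS.
  have e1 := ltn_neq _ _ lt0j; have e2 := ltn_neq _ _ ltjM; have e3 := ltn_neq _ _ (ltn_trans lt0j ltjM).
  by apply: (tri _ _ ord_max); rewrite ?e1 ?e2 ?e3 // ltU.
have gtU (i j : 'I_n.+1) : (i < j)%N -> e_ j i \in mon_gen U.
  move=> ij; have j0 : j != ord0 by rewrite -val_eqE /= -lt0n (leq_ltn_trans _ ij).
  have [->|i0] := eqVneq i ord0; first exact: geU0.
  apply: (tri _ _ ord0); rewrite ?(ltn_neq _ _ ij) // 1?eq_sym //; [exact: ltU|exact: geU0|].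
  by apply: ltU; rewrite lt0n.
apply: idgensetE.
  apply/subsetP => x /imsetP[p _ ->]; rewrite /arc.
  by case: ifP => _; rewrite !inE e_idem eqxx.
apply: subset_trans (sub_mon_gen _) _; apply: sub_idgen_trans.
  exact: mon_gen_submonoid.
by move=> i j; rewrite neq_ltn => /orP[]; [exact: ltU|exact: gtU].
Qed.

(** * Wreath form, labelled maps and the idempotents of T(X, P) *)

Section Wreath.
Local Open Scope group_scope.
Variables m n : nat.
Implicit Types (i j : 'I_m) (F : 'I_m -> trans 'I_n) (al be : trans 'I_m)
  (x y : trans ('I_m * 'I_n)%type).

Lemma wreathE F al i (a : 'I_n) : wreath F al (i, a) = (al i, F i a).
Proof. by rewrite ffunE. Qed.

Lemma wreathM F F' al be :
  wreath F al * wreath F' be = wreath (fun i => F i * F' (al i)) (al * be).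
Proof. by apply/ffunP => -[i a]; rewrite trans_mulE !wreathE !trans_mulE. Qed.

Lemma eq_wreath F F' al : F =1 F' -> wreath F al = wreath F' al.
Proof. by move=> h; apply/ffunP => -[i a]; rewrite !wreathE h. Qed.

Lemma eq_wreath_in F F' al (H : {set trans ('I_m * 'I_n)%type}) :
  F =1 F' -> wreath F al \in H -> wreath F' al \in H.
Proof. by move=> h; rewrite (eq_wreath _ h). Qed.

Lemma wreath1 : wreath (fun=> 1 : trans 'I_n) (1 : trans 'I_m) = 1.
Proof. by apply/ffunP => -[i a]; rewrite wreathE !trans_oneE. Qed.

Lemma wreath_TXP F al : wreath F al \in TXP m n.
Proof.
rewrite inE; apply/forallP => i; apply/existsP; exists (al i).
apply/subsetP => y /imsetP[[i' a]]; rewrite !inE /= => /eqP -> ->.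
by rewrite wreathE.
Qed.

(** The map of blocks is read off at a reference point [o]; for [x] in [TXP m n] every [o] gives the
    same map. *)
Definition bar (o : 'I_n) x : trans 'I_m := [ffun i => (x (i, o)).1].
Definition fiber i x : trans 'I_n := [ffun a => (x (i, a)).2].

Lemma fiber_wreath F al i : fiber i (wreath F al) = F i.
Proof. by apply/ffunP => a; rewrite ffunE wreathE. Qed.

Lemma bar_wreath o F al : bar o (wreath F al) = al.
Proof. by apply/ffunP => i; rewrite ffunE wreathE. Qed.

Lemma TXP_fst x i a b : x \in TXP m n -> (x (i, a)).1 = (x (i, b)).1.
Proof.
rewrite inE => /forallP/(_ i)/existsP[j /subsetP h].
have {}h c : (x (i, c)).1 = j.
  by apply/eqP; have := h (x (i, c)); rewrite inE; apply; apply: imset_f; rewrite inE.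
by rewrite !h.
Qed.

Lemma TXP_wreath o x : x \in TXP m n -> x = wreath (fiber^~ x) (bar o x).
Proof.
move=> xP; apply/ffunP => -[i a]; rewrite wreathE !ffunE.
by rewrite -(TXP_fst i a o xP); case: (x _).
Qed.

Lemma wreathM3 F F' F'' al :
  wreath F 1 * wreath F' al * wreath F'' 1 = wreath (fun i => F i * F' i * F'' (al i)) al.
Proof.
by apply/ffunP => -[i a]; rewrite !trans_mulE !wreathE !trans_mulE !trans_oneE.
Qed.

Lemma at_block1 i : at_block i (1 : trans 'I_n) = 1.
Proof. by rewrite -wreath1; apply: eq_wreath => j; rewrite if_same. Qed.

Lemma at_blockM i (g h : trans 'I_n) : at_block i (g * h) = at_block i g * at_block i h.
Proof.
rewrite wreathM mulg1; apply: eq_wreath => j; rewrite trans_oneE.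
by case: eqP => //; rewrite mulg1.
Qed.

Lemma at_block_idem i (g : trans 'I_n) : g * g = g -> at_block i g * at_block i g = at_block i g.
Proof. by move=> gg; rewrite -at_blockM gg. Qed.

Lemma e_perm_idem i j (f : 'S_n) : i != j -> e_perm i j f * e_perm i j f = e_perm i j f.
Proof.
move=> ij; rewrite wreathM e_idem; apply: eq_wreath => p; rewrite e_E.
by case: (p =P j) => [_|/eqP/negPf->]; rewrite ?(negPf ij) mulg1.
Qed.

(** Blocks are multiplied in one at a time, along the enumeration of 'I_m. *)
Lemma wreath_gen (H : {set trans ('I_m * 'I_n)%type}) F :
  is_submonoid H -> (forall i, at_block i (F i) \in H) -> wreath F 1 \in H.
Proof.
move=> /submonoidP[H1 HM] FH.
have -> : wreath F 1 = wreath (fun k => if k \in enum 'I_m then F k else 1) 1.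
  by apply: eq_wreath => k; rewrite mem_enum.
elim: (enum 'I_m) (enum_uniq 'I_m) => [_|i s IH /= /andP[is_ us]].
  by rewrite (eq_wreath (F' := fun=> 1)) ?wreath1.
have -> : wreath (fun k => if k \in i :: s then F k else 1) 1 =
   at_block i (F i) * wreath (fun k => if k \in s then F k else 1) 1.
  rewrite wreathM mulg1; apply: eq_wreath => k; rewrite trans_oneE inE.
  by case: eqP => [->|_]; rewrite ?(negPf is_) ?mulg1 ?mul1g.
by apply: HM => //; apply: IH.
Qed.

(* The twisted lifts form a subsemigroup: they are the conjugates of the lifts [1, ..., 1; al]
   by the unit [h_1, ..., h_m; 1], which does not itself belong to H. *)
Lemma twisted_gen (H : {set trans ('I_m * 'I_n)%type}) (V : {set trans 'I_m}) (h : 'I_m -> 'S_n) :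
  is_submonoid H ->
  (forall al, al \in V -> wreath (fun i => trans_of_perm ((h i)^-1 * h (al i))) al \in H) ->
  forall al, al \in sgp_gen V -> wreath (fun i => trans_of_perm ((h i)^-1 * h (al i))) al \in H.
Proof.
move=> /submonoidP[_ HM] hV al alV.
pose N := [set al : trans 'I_m | wreath (fun i => trans_of_perm ((h i)^-1 * h (al i))) al \in H].
suff: al \in N by rewrite inE.
apply: (subsetP (sgp_gen_subset (M := N) _ _)) alV; last by apply/subsetP => be /hV; rewrite inE.
apply/subsemigroupP => x y; rewrite !inE => xH yH.
move: (HM _ _ xH yH); rewrite wreathM => xyH; apply: eq_wreath_in xyH => i.
by rewrite -trans_of_permM trans_mulE mulgA mulgK.
Qed.

(** The product sends block j to itself by [f * g], passing through block i, and block i to block j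
    by [g]; each further factor appends [f * g] to both labels. *)
Lemma e_perm_pow i j (f g : 'S_n) k : i != j ->
  (e_perm i j f * e_perm j i g) ^+ k.+1 =
  wreath (fun p => if p == j then trans_of_perm ((f * g) ^+ k.+1)
                   else if p == i then trans_of_perm (g * (f * g) ^+ k) else 1) (e_ j i).
Proof.
move=> ij; have ji : j != i by rewrite eq_sym.
have e_ijji : e_ i j * e_ j i = e_ j i.
  apply/ffunP => p; rewrite trans_mulE !e_E.
  by case: (p =P j) => [->|_] //; rewrite eqxx (negPf ji).
have base : e_perm i j f * e_perm j i g =
  wreath (fun p => if p == j then trans_of_perm (f * g)
                   else if p == i then trans_of_perm g else 1) (e_ j i).
  rewrite wreathM e_ijji; apply: eq_wreath => p; rewrite e_E.
  by case: (p =P j) => _; rewrite ?(negPf ij) ?eqxx ?trans_of_permM ?mul1g.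
elim: k => [|k IH].
  by rewrite expg1 base; apply: eq_wreath => p; rewrite expg1 expg0 mulg1.
rewrite expgSr {}IH base wreathM e_idem; apply: eq_wreath => p.
have [->|pj] := eqVneq p j; first by rewrite e_same eqxx -trans_of_permM -expgSr.
rewrite e_E; have [_|pi] := eqVneq p i; last by rewrite (negPf pj) ?(negPf pi) mul1g.
by rewrite eqxx -trans_of_permM -mulgA -expgSr.
Qed.

Lemma submonoidX (T : finType) (H : {set trans T}) (u : trans T) k :
  is_submonoid H -> u \in H -> u ^+ k \in H.
Proof.
move=> /submonoidP[H1 HM] uH; elim: k => [|k IH]; first by rewrite expg0.
by rewrite expgS HM.
Qed.

(** Raising the product to the order of [f * g] trivializes the label at j and leaves the label
    [f^-1] at i. *)
Lemma e_perm_flip (H : {set trans ('I_m * 'I_n)%type}) i j (f g : 'S_n) :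
  is_submonoid H -> i != j ->
  e_perm i j f \in H -> e_perm j i g \in H -> e_perm j i f^-1 \in H.
Proof.
move=> hH ij fH gH; have := submonoidX #[f * g] hH ((submonoidP _ hH).2 _ _ fH gH).
have := order_gt0 (f * g); case o: #[f * g] => [//|k] _.
rewrite e_perm_pow // -o expg_order.
have -> : g * (f * g) ^+ k = f^-1.
  by apply: (mulgI f); rewrite mulgA -expgS -o expg_order mulgV.
apply: eq_wreath_in => p.
by case: (p =P j) => [->|_]; rewrite ?(eq_sym j) ?(negPf ij) // trans_of_perm1.
Qed.

(** [e_perm_flip] needs some labelled map in the opposite direction: an element of [A] supplies it
    for one direction, an element of [B] for the other. *)
Lemma e_perm_flip_all (H : {set trans ('I_m * 'I_n)%type}) i j (A B : {set 'S_n}) :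
  is_submonoid H -> i != j -> A != set0 -> B != set0 -> A :|: B = setT ->
  (forall f, f \in A -> e_perm i j f \in H) ->
  (forall f, f \in B -> e_perm j i f^-1 \in H) ->
  forall f, e_perm i j f \in H /\ e_perm j i f \in H.
Proof.
move=> hH ij /set0Pn[a aA] /set0Pn[b bB] AB AH BH.
have ji : j != i by rewrite eq_sym.
have AorB f : f \in A \/ f \in B by apply/orP; rewrite -in_setU AB inE.
have ijH f : e_perm i j f \in H.
  case: (AorB f) => [|/BH fH]; first exact: AH.
  by have := e_perm_flip hH ji fH (AH a aA); rewrite invgK.
split=> //; rewrite -[f]invgK; exact: e_perm_flip hH ij (ijH f^-1) (BH b bB).
Qed.

Lemma idems_TXP_sub (H : {set trans ('I_m * 'I_n)%type}) :
  is_submonoid H ->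
  (forall i g, g \in idgen_trans n -> at_block i g \in H) ->
  (forall (h : 'I_m -> 'S_n) al, al \in sing_trans m ->
     wreath (fun i => trans_of_perm ((h i)^-1 * h (al i))) al \in H) ->
  idems (TXP m n) \subset H.
Proof.
move=> hH hU hV; have [_ HM] := submonoidP _ hH.
apply/subsetP => x; rewrite inE => /andP[xP /eqP xx].
have [n0|n0] := posnP n.
  suff -> : x = 1 by have [] := submonoidP _ hH.
  by apply/ffunP => -[i a]; exfalso; have := ltn_ord a; rewrite {2}n0.
pose o := Ordinal n0; have xE := TXP_wreath o xP.
set F := fiber^~ x in xE; set al := bar o x in xE.
(* The components of x x = x: [al] is idempotent, and [F (al i)] acts trivially after [F i]. In
   particular [F i] is idempotent on each block fixed by [al]. *)
have alal : al * al = al.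
  by have := congr1 (bar o) xx; rewrite xE wreathM !bar_wreath.
have FF i : F i * F (al i) = F i.
  by have := congr1 (fiber i) xx; rewrite {1 2}xE wreathM fiber_wreath.
have unitF i : F i * F i = F i -> F i \in idgen_trans n.
  by move=> ii; apply: mem_mon_gen; rewrite !inE ii eqxx.
have al_fix i : al (al i) = al i by rewrite -trans_mulE alal.
have wH G : (forall i, G i \in idgen_trans n) -> wreath G 1 \in H.
  by move=> GU; apply: wreath_gen => // i; apply/hU/GU.
have [alI|alN] := boolP (injectiveb al).
  have al1 : al = 1 by apply: idem_inj alal _; apply/injectiveP.
  rewrite xE al1; apply: wH => i; apply: unitF.
  by have := FF i; rewrite al1 trans_oneE.
have alS : al \in sing_trans m by rewrite inE mem_sym.
(* On a block i moved by al, a bijective F i is absorbed by the label h_i^-1 and a singular F i is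
   generated within the block. *)
pose s i := [pick s : 'S_n | trans_of_perm s == F i].
pose h i : 'S_n := if al i == i then 1 else if s i is Some t then t^-1 else 1.
pose g i := if al i == i then 1 else if s i is Some t then 1 else F i.
(* The last factor applies [F] on the blocks fixed by [al]. A moved block lands in one of these,
   where [h] is 1, and by [FF] the last factor does not alter the [F i] already obtained from [g]
   and the label. *)
have xgk : x = wreath g 1 * wreath (fun i => trans_of_perm ((h i)^-1 * h (al i))) al
                 * wreath (fun i => if al i == i then F i else 1) 1.
  rewrite {1}xE wreathM3; apply: eq_wreath => i.
  rewrite /g /h al_fix eqxx mulg1 /s.
  case: (al i =P i) => [ii|_]; first by rewrite invg1 trans_of_perm1 !mul1g ii.
  case: pickP => [t /eqP tF|_]; first by rewrite invgK tF mul1g FF.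
  by rewrite invg1 trans_of_perm1 mulg1 FF.
rewrite xgk; apply: (HM); last first.
  apply: wH => i; case: eqP => [ii|_]; last exact: mon_gen1.
  by apply: unitF; have := FF i; rewrite ii.
apply: HM; last exact: hV.
apply: wH => i; rewrite /g; case: eqP => [_|_]; first exact: mon_gen1.
rewrite /s; case: pickP => [_ _|nF]; first exact: mon_gen1.
apply: (subsetP (sing_idgen_trans n)); rewrite inE; apply/imsetP => -[t _ tF].
by have := nF t; rewrite tF eqxx.
Qed.

End Wreath.

(** * Idempotents of defect 1 *)

Section Defect.
Local Open Scope group_scope.
Variable m : nat.
Implicit Types (i j : 'I_m) (x : trans 'I_m).

Lemma e_defect1 i j : i != j -> e_ i j \in idems (defect1 m).
Proof.
move=> ij; rewrite !inE e_idem eqxx andbT.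
have -> : e_ i j @: [set: 'I_m] = [set~ j].
  apply/setP => p; rewrite !inE; apply/imsetP/idP => [[q _ ->]|pj].
    by rewrite e_E; case: (q =P j) => // /eqP.
  by exists p; rewrite ?inE // e_E (negPf pj).
by rewrite cardsC1 card_ord.
Qed.

(** The image is the complement of a single point j, and an idempotent fixes its image pointwise. *)
Lemma idem_defect1P x : 0 < m -> x \in idems (defect1 m) -> exists i j, i != j /\ x = e_ i j.
Proof.
move=> m0; rewrite !inE => /andP[/eqP cx /eqP xx].
have [j jx] : exists j, j \notin x @: setT.
  apply/existsP; rewrite -negb_forall; apply/negP => /forallP h.
  have h' : x @: setT = setT by apply/setP => p; rewrite h inE.
  by move: cx; rewrite h' cardsT card_ord => e; move: m0; rewrite -ltn_predL -e ltnn.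
have imE : x @: setT = [set~ j].
  apply/eqP; rewrite eqEcard cx cardsC1 card_ord leqnn andbT.
  by apply/subsetP => p px; rewrite !inE; apply: contraNneq jx => <-.
exists (x j), j; split.
  by apply: contraNneq jx => {1}<-; apply: imset_f.
apply/ffunP => p; rewrite e_E; case: (p =P j) => [->//|/eqP pj].
have : p \in x @: setT by rewrite imE !inE.
by case/imsetP => q _ ->; rewrite -trans_mulE xx.
Qed.

Lemma sing_subsemigroup : is_subsemigroup (sing_trans m).
Proof.
apply/subsemigroupP => x y _ /sing_transP[c hc]; apply/sing_transP; exists c => p.
by rewrite trans_mulE.
Qed.

(** Provides one admissible [V], namely all of E(D_m), for the computation of the ranks. *)
Lemma sing_gen_defect1 : 0 < m -> sing_trans m = sgp_gen (idems (defect1 m)).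
Proof.
move=> m0; apply/eqP; rewrite eqEsubset; apply/andP; split.
  apply/bigcapsP => M /andP[hM /subsetP eM].
  by apply: sing_trans_sub => // i j ij; apply/eM/e_defect1.
apply: sgp_gen_subset; first exact: sing_subsemigroup.
by apply/subsetP => x /(idem_defect1P m0)[i [j [ij ->]]]; apply: e_sing.
Qed.

End Defect.

(** * What [Wset] generates, and its size *)

Section Wset.
Local Open Scope group_scope.
Variables m n : nat.
Implicit Types (i j : 'I_m) (V : {set trans 'I_m}) (A B : 'I_m -> 'I_m -> {set 'S_n}).

Lemma at_block_idems i (g : trans 'I_n) : g * g = g -> at_block i g \in idems (TXP m n).
Proof. by move=> gg; rewrite inE wreath_TXP at_block_idem ?eqxx. Qed.

Lemma e_perm_idems i j (f : 'S_n) : i != j -> e_perm i j f \in idems (TXP m n).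
Proof. by move=> ij; rewrite inE wreath_TXP e_perm_idem ?eqxx. Qed.

Lemma WsetP V A B x : x \in Wset V A B -> exists i j f, i != j /\ x = e_perm i j f.
Proof.
case/setUP => /bigcupP[[i j]]; rewrite inE /= => /and3P[ij _ _].
  by case/imsetP => f _ ->; exists i, j, f.
have {}ij : i != j by rewrite -val_eqE neq_ltn ij.
by case/setUP => /imsetP[f _ ->]; [exists i, j, f|exists j, i, f^-1; rewrite eq_sym].
Qed.

Lemma Wset_gen_e_perm (H : {set trans ('I_m * 'I_n)%type}) V A B i j (f : 'S_n) :
  is_submonoid H -> Wset V A B \subset H ->
  (forall i j, (i, j) \in Xi V -> [/\ A i j != set0, B i j != set0 & A i j :|: B i j = setT]) ->
  i != j -> e_ i j \in V -> e_perm i j f \in H.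
Proof.
move=> hH /subsetP WH hAB ij eV.
have xi (k l : 'I_m) : k != l -> (k, l) \in Xi V -> forall f, e_perm k l f \in H /\ e_perm l k f \in H.
  move=> kl klV; have [A0 B0 AB] := hAB _ _ klV.
  apply: (e_perm_flip_all hH kl A0 B0 AB) => g gA; apply: WH; apply/setUP; right;
    apply/bigcupP; exists (k, l) => //=; apply/setUP; [left|right]; exact: imset_f.
have [eV'|eV'] := boolP (e_ j i \in V); last first.
  apply: WH; apply/setUP; left; apply/bigcupP; exists (i, j); last exact: imset_f.
  by rewrite inE /= ij eV.
(* [Xi V] holds sorted pairs only, so the pair is sorted first; [xi] covers both directions. *)
move: (ij); rewrite -val_eqE neq_ltn => /orP[lt|lt].
  by have [] := xi i j ij _ f; first by rewrite inE /= lt eV.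
by have [] := xi j i _ _ f; rewrite 1?eq_sym // inE /= lt eV eV'.
Qed.

(* A sorted pair p and f : 'S_n account for one of e_perm p.1 p.2 f, e_perm p.2 p.1 f^-1 when p is
   in Xi V, and for one of e_perm p.1 p.2 f, e_perm p.2 p.1 f otherwise. *)
Lemma card_Wset V A B :
  (forall i j, (i, j) \in Xi V -> [disjoint A i j & B i j]) ->
  #|Wset V A B| <= n`! * 'C(m, 2).
Proof.
move=> AB.
pose phi (t : ('I_m * 'I_m) * 'S_n) :=
  if t.1 \in Xi V then
    if t.2 \in A t.1.1 t.1.2 then e_perm t.1.1 t.1.2 t.2 else e_perm t.1.2 t.1.1 t.2^-1
  else if t.1 \in Phi V then e_perm t.1.1 t.1.2 t.2 else e_perm t.1.2 t.1.1 t.2.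
pose D := setX [set p : 'I_m * 'I_m | p.1 < p.2] [set: 'S_n].
apply: (@leq_trans #|phi @: D|); last first.
  apply: leq_trans (leq_imset_card _ _) _.
  by rewrite cardsX card_ltn_pairs cardsT card_Sn mulnC.
apply: subset_leq_card; apply/subsetP => x; case/setUP => /bigcupP[[i j]] ijV.
  have := ijV; rewrite inE /= => /and3P[ij ijV1 jiV] /imsetP[f _ ->].
  move: (ij); rewrite -val_eqE neq_ltn => /orP[lt|lt]; apply/imsetP.
    by exists ((i, j), f); rewrite ?inE ?andbT // /phi /= ijV inE /= (negPf jiV) !andbF.
  exists ((j, i), f); rewrite ?inE ?andbT //= /phi /=.
  by rewrite !inE /= (negPf jiV) ijV1 !andbF.
have := ijV; rewrite inE /= => /and3P[lt _ _] /setUP[] /imsetP[f fAB ->]; apply/imsetP.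
  by exists ((i, j), f); rewrite ?inE ?andbT // /phi /= ijV fAB.
exists ((i, j), f); rewrite ?inE ?andbT //= /phi ijV /=.
by have /disjointFl := AB i j ijV; move/(_ f fAB) => ->.
Qed.

End Wset.
(** Choosing a witness for each index is injective on [D], as no [u] serves two indices. In the
    kernel counts below, [P t u] says that [u] has the kernel indexed by [t]. *)
Lemma leq_card_witness (I Y : finType) (D : {set I}) (U : {set Y}) (P : I -> Y -> bool) :
  (forall t, t \in D -> exists u, u \in U /\ P t u) ->
  (forall t t' u, t \in D -> t' \in D -> P t u -> P t' u -> t = t') ->
  #|D| <= #|U|.
Proof.
move=> ex inj; pose f t := [pick u in U | P t u].
have fP t : t \in D -> exists u, [/\ f t = Some u, u \in U & P t u].
  move=> tD; rewrite /f; case: pickP => [u /andP[uU tu]|no]; first by exists u.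
  by have [u [uU tu]] := ex t tD; have := no u; rewrite uU tu.
rewrite -(card_in_imset (f := f) (D := D)); last first.
  move=> t t' tD t'D; have [u [-> _ tu]] := fP t tD; have [u' [-> _ tu']] := fP t' t'D.
  by case=> uu'; apply: (inj t t' u) => //; rewrite uu'.
(* The chosen witness is an option, so the comparison is with the image of [U] under [Some]. *)
rewrite -(card_imset (mem U) (@Some_inj _)); apply/subset_leq_card/subsetP => y /imsetP[t tD ->].
by have [u [-> uU _]] := fP t tD; apply: imset_f.
Qed.

(** * Lower bounds from the kernels of generators *)

Section LowerBound.
Local Open Scope group_scope.
Variables m n : nat.
Implicit Types (i j : 'I_m) (x y u v : trans ('I_m * 'I_n)%type) (U : {set trans ('I_m * 'I_n)%type}).
Local Notation S := (mon_gen (idems (TXP m n))).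

Definition same_ker x y := [forall p, forall q, (x p == x q) == (y p == y q)].

Lemma same_kerP x y : reflect (forall p q, (x p = x q) <-> (y p = y q)) (same_ker x y).
Proof.
apply: (iffP forallP) => [h p q|h p].
  by have /forallP/(_ q)/eqP e := h p; split => /eqP; [rewrite e|rewrite -e] => /eqP.
by apply/forallP => q; apply/eqP; apply/idP/idP => /eqP/h/eqP.
Qed.

Lemma bar_mul (o : 'I_n) x y : x \in TXP m n -> y \in TXP m n -> bar o (x * y) = bar o x * bar o y.
Proof.
move=> /(TXP_wreath o) {1 2}-> /(TXP_wreath o) {1 2}->.
by rewrite wreathM !bar_wreath.
Qed.

Lemma TXP_submonoid : 0 < n -> is_submonoid (TXP m n).
Proof.
move=> n0; pose o := Ordinal n0; apply/submonoidP; split.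
  by rewrite -wreath1 wreath_TXP.
by move=> x y /(TXP_wreath o) -> /(TXP_wreath o) ->; rewrite wreathM wreath_TXP.
Qed.

Lemma S_TXP x : 0 < n -> x \in S -> x \in TXP m n.
Proof.
move=> n0; apply: subsetP; apply: mon_gen_subset; first exact: TXP_submonoid.
by apply/subsetP => y; rewrite inE => /andP[].
Qed.

(** Off block j the map is the identity, and on block j it is the injection sending (j, a) to (i, f
    a). *)
Lemma e_perm_kerP i j (f : 'S_n) p q : i != j -> e_perm i j f p = e_perm i j f q ->
  [\/ p = q, exists a, p = (i, f a) /\ q = (j, a) | exists a, q = (i, f a) /\ p = (j, a)].
Proof.
move: p q => [p a] [q b] ij; rewrite !wreathE !e_E.
case: (p =P j) => [->|_]; case: (q =P j) => [->|_]; rewrite !ffunE => -[].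
- by move=> /perm_inj ->; constructor 1.
- by move=> <- <-; constructor 3; exists a.
- by move=> -> ->; constructor 2; exists b.
- by move=> -> ->; constructor 1.
Qed.

Lemma e_perm_merge i j (f : 'S_n) a : i != j -> e_perm i j f (i, f a) = e_perm i j f (j, a).
Proof.
by move=> ij; rewrite !wreathE e_same e_E eqxx (negPf ij) ffunE [RHS]/= ffunE.
Qed.

Lemma factor_e_perm U i j (f : 'S_n) : 0 < n -> mon_gen U = S -> i != j ->
  exists u, u \in U /\ same_ker u (e_perm i j f).
Proof.
move=> n0 US ij; pose o := Ordinal n0; set x := e_perm i j f.
have xi c : x (i, c) = (i, c) by rewrite wreathE e_same (negPf ij) ffunE.
have xU : x \in mon_gen U by rewrite US mem_mon_gen ?e_perm_idems.
have x1 : x != 1.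
  apply/eqP => x1; have := e_perm_merge f o ij; rewrite -/x x1 !trans_oneE => -[ji].
  by rewrite ji eqxx in ij.
have [u [v [uU u1 _ xuv]]] := mon_gen_factor xU x1.
have uS : u \in S by rewrite -US mem_mon_gen.
have ux p q : u p = u q -> x p = x q by rewrite xuv !trans_mulE => ->.
have uP := S_TXP n0 uS.
have [a ua] : exists a, u (i, f a) = u (j, a).
  have /injectivePn[p [q pq upq]] : ~~ injectiveb u.
    by apply: contra u1 => /injectiveP/(mon_gen_idems_inj uS)->.
  have [epq|[a [pE qE]]|[a [qE pE]]] := e_perm_kerP ij (ux _ _ upq).
  - by rewrite epq eqxx in pq.
  - by exists a; rewrite -pE -qE.
  - by exists a; rewrite -pE -qE.
(* As [x] is the identity on block i, [u] is injective there, hence maps it onto a whole block, to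
   which block j is sent as well. So every u (j, b) equals some u (i, c), and the kernel of [x]
   forces c = f b. *)
have injc : injective (fun c => (u (i, c)).2).
  move=> c c' cc'; have /ux : u (i, c) = u (i, c').
    by rewrite [LHS]surjective_pairing [RHS]surjective_pairing cc' (TXP_fst i c c' uP).
  by rewrite !xi => -[].
have ub b : u (i, f b) = u (j, b).
  have [g _ gK] := injF_bij injc; pose c := g (u (j, b)).2.
  have ucb : u (i, c) = u (j, b).
    rewrite [LHS]surjective_pairing [RHS]surjective_pairing gK.
    by rewrite (TXP_fst i c (f a) uP) ua (TXP_fst j a b uP).
  by have := ux _ _ ucb; rewrite xi -(e_perm_merge f b ij) xi => -[<-].
exists u; split=> //; apply/same_kerP => p q; split; first exact: ux.
by case/(e_perm_kerP ij) => [->//|[b [-> ->]]|[b [-> ->]]].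
Qed.

(** Separates the generators sharing a kernel with some [e_perm i j f] from those sharing one with a
    map inside a block, so that the two counts add up. *)
Definition merges u := [exists p, exists q, (p.1 != q.1) && (u p == u q)].

(** Since [e_perm i j f] and [e_perm j i f^-1] have the same kernel, the distinct kernels are
    indexed by sorted pairs together with a permutation. *)
Lemma card_merges U : 0 < n -> mon_gen U = S ->
  n`! * 'C(m, 2) <= #|[set u in U | merges u]|.
Proof.
move=> n0 US; pose o := Ordinal n0.
pose D := setX [set p : 'I_m * 'I_m | p.1 < p.2] [set: 'S_n].
have -> : (n`! * 'C(m, 2) = #|D|)%N by rewrite cardsX card_ltn_pairs cardsT card_Sn mulnC.
pose P (t : ('I_m * 'I_m) * 'S_n) u := same_ker u (e_perm t.1.1 t.1.2 t.2).
have neq (t : ('I_m * 'I_m) * 'S_n) : t \in D -> t.1.1 != t.1.2.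
  by rewrite !inE andbT => lt; rewrite -val_eqE neq_ltn lt.
apply: (leq_card_witness (P := P)) => [[[i j] f] /neq /= ij|].
  have [u [uU uk]] := factor_e_perm f n0 US ij; exists u; split=> //.
  rewrite inE uU; apply/existsP; exists (i, f o); apply/existsP; exists (j, o).
  by rewrite ij /=; apply/eqP; apply/(same_kerP _ _ uk)/e_perm_merge.
move=> [[i j] f] [[i' j'] f'] u tD tD' /same_kerP uk /same_kerP uk'.
have ij := neq _ tD; have ij' := neq _ tD'.
move: tD tD' ij ij' uk uk'; rewrite !inE !andbT /= => lt lt' ij ij' uk uk'.
(* The pair (i, f a), (j, a) must be a kernel pair of the second map as well; the crossed match
   would give both i < j and j < i. *)
have h a : [/\ i = i', j = j' & f a = f' a].
  have /uk /uk' := e_perm_merge f a ij.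
  case/(e_perm_kerP ij') => [[e _]|[b [[-> ->] [-> ->]]] //|[b [[e _] [e' _]]]].
    by rewrite e eqxx in ij.
  by move: lt lt'; rewrite e e' => lt /(ltn_trans lt); rewrite ltnn.
have [-> -> _] := h o; congr (_, _); apply/permP => a; by have [] := h a.
Qed.

(** Here the kernel has one nontrivial pair, so a first factor that is not injective already has the
    whole kernel. *)
Lemma factor_at_block U i (a b : 'I_n) : mon_gen U = S -> a != b ->
  exists u, u \in U /\ same_ker u (at_block i (e_ a b)).
Proof.
move=> US ab; set x := at_block i (e_ a b).
have xab : x (i, a) = x (i, b) by rewrite !wreathE eqxx e_same e_E eqxx.
have xk p q : x p = x q -> [\/ p = q, p = (i, a) /\ q = (i, b) | q = (i, a) /\ p = (i, b)].
  move: p q => [p c] [q d]; rewrite !wreathE !trans_oneE => -[<-].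
  case: (p =P i) => [->|_]; last by rewrite !trans_oneE => ->; constructor 1.
  rewrite !e_E; case: (c =P b) => [->|_]; case: (d =P b) => [->|_].
  - by constructor 1.
  - by move=> <-; constructor 3.
  - by move=> ->; constructor 2.
  - by move=> ->; constructor 1.
have xU : x \in mon_gen U by rewrite US mem_mon_gen ?at_block_idems ?e_idem.
have x1 : x != 1.
  by apply/eqP => x1; move: xab; rewrite x1 !trans_oneE => -[e]; rewrite e eqxx in ab.
have [u [v [uU u1 _ xuv]]] := mon_gen_factor xU x1.
have uS : u \in S by rewrite -US mem_mon_gen.
have ux p q : u p = u q -> x p = x q by rewrite xuv !trans_mulE => ->.
have uab : u (i, a) = u (i, b).
  have /injectivePn[p [q pq upq]] : ~~ injectiveb u.
    by apply: contra u1 => /injectiveP/(mon_gen_idems_inj uS)->.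
  case: (xk _ _ (ux _ _ upq)) => [e|[<- <-]|[<- <-]] //.
  by rewrite e eqxx in pq.
exists u; split=> //; apply/same_kerP => p q; split; first exact: ux.
by case/xk => [->//|[-> ->]|[-> ->]].
Qed.

(** The kernels are indexed by a block and a sorted pair in it, [e_ a b] and [e_ b a] having the
    same kernel. *)
Lemma card_non_merges U : mon_gen U = S ->
  m * 'C(n, 2) <= #|[set u in U | ~~ merges u]|.
Proof.
move=> US; pose D := setX [set: 'I_m] [set p : 'I_n * 'I_n | p.1 < p.2].
have -> : (m * 'C(n, 2) = #|D|)%N by rewrite cardsX card_ltn_pairs cardsT card_ord.
pose P (t : 'I_m * ('I_n * 'I_n)) u := same_ker u (at_block t.1 (e_ t.2.1 t.2.2)).
have neq (t : 'I_m * ('I_n * 'I_n)) : t \in D -> t.2.1 != t.2.2.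
  by rewrite !inE /= => lt; rewrite -val_eqE neq_ltn lt.
apply: (leq_card_witness (P := P)) => [[i [a b]] /neq /= ab|].
  have [u [uU uk]] := factor_at_block i US ab; exists u; split=> //.
  rewrite inE uU; apply/existsP => -[[p c] /existsP[[q d] /= /andP[pq /eqP upq]]].
  have := (same_kerP _ _ uk _ _).1 upq; rewrite !wreathE !trans_oneE => -[e].
  by rewrite e eqxx in pq.
move=> [i [a b]] [i' [a' b']] u tD tD' /same_kerP uk /same_kerP uk'.
have ab := neq _ tD; move: tD tD' ab uk uk'; rewrite !inE /= => lt lt' ab uk uk'.
have /uk/uk' : at_block i (e_ a b) (i, a) = at_block i (e_ a b) (i, b).
  by rewrite !wreathE eqxx e_same e_E eqxx.
rewrite !wreathE !trans_oneE => -[].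
case: (i =P i') => [->|_]; last by rewrite !trans_oneE => e; rewrite e eqxx in ab.
rewrite !e_E; case: (a =P b') => [e|_]; case: (b =P b') => [e'|_].
- by rewrite e e' eqxx in ab.
- by move=> a'b; move: lt lt'; rewrite e a'b => lt /(ltn_trans lt); rewrite ltnn.
- by move=> ->; rewrite e'.
- by move=> e; rewrite e eqxx in ab.
Qed.

(** A blockwise form of [mon_gen_idems_inj]: once the block map is 1, fibers multiply block by
    block, and the same argument applies in each block. *)
Lemma S_units (o : 'I_n) x : x \in S -> injective (bar o x) ->
  bar o x = 1 /\ forall i, injective (fiber i x) -> fiber i x = 1.
Proof.
have n0 : 0 < n by case: n o => // -[].
pose N := [set x in TXP m n | injectiveb (bar o x) ==>
   ((bar o x == 1) && [forall i, injectiveb (fiber i x) ==> (fiber i x == 1)])].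
suff /subsetP SN : S \subset N.
  move=> /SN; rewrite inE => /andP[_ /implyP h] /injectiveP /h /andP[/eqP-> /forallP h'].
  by split=> // i /injectiveP; have /implyP h'' := h' i => /h'' /eqP.
apply: mon_gen_subset; last first.
  apply/subsetP => y; rewrite inE => /andP[yP /eqP yy]; rewrite inE yP /=.
  apply/implyP => /injectiveP yI.
  have b1 : bar o y = 1 by apply: idem_inj yI; rewrite -bar_mul // yy.
  rewrite b1 eqxx /=; apply/forallP => i; apply/implyP => /injectiveP iI; apply/eqP.
  apply: idem_inj iI; have := congr1 (fiber i) yy.
  by rewrite {1 2}(TXP_wreath o yP) wreathM !fiber_wreath b1 trans_oneE.
apply/submonoidP; split.
  rewrite inE -wreath1 wreath_TXP bar_wreath eqxx; apply/implyP => _; apply/forallP => i.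
  by rewrite fiber_wreath eqxx implybT.
move=> y z; rewrite ![_ \in N]inE => /andP[yP hy] /andP[zP hz].
have [_ TM] := submonoidP _ (TXP_submonoid n0); rewrite TM //=.
apply/implyP; rewrite bar_mul // => /injectiveP yzI.
move: hy => /implyP/(_ (introT (injectiveP _) (trans_inj_mulr yzI)))/andP[/eqP by1 /forallP hy].
move: yzI; rewrite by1 mul1g => /injectiveP/(implyP hz)/andP[/eqP bz1 /forallP hz'].
rewrite bz1 eqxx /=; apply/forallP => i; apply/implyP.
have -> : fiber i (y * z) = fiber i y * fiber i z.
  by rewrite {1}(TXP_wreath o yP) {1}(TXP_wreath o zP) wreathM fiber_wreath by1 trans_oneE.
move=> /injectiveP yzI.
have /eqP y1 := implyP (hy i) (introT (injectiveP _) (trans_inj_mulr yzI)).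
by move: yzI; rewrite y1 !mul1g => /injectiveP/(implyP (hz' i)).
Qed.

End LowerBound.

(** * Blocks with two points *)

Section TwoPoints.
Local Open Scope group_scope.
Variables m : nat.
Local Notation S := (mon_gen (idems (TXP m 2))).
Implicit Types (i : 'I_m) (c : 'I_2).

Definition const_trans c : trans 'I_2 := [ffun=> c].

Lemma not_inj_const (g : trans 'I_2) : ~~ injectiveb g -> forall a b, g a = g b.
Proof.
have two (a b p q : 'I_2) : p != q -> (a == p) || (a == q).
  by case: a p q => [[|[|//]] ?] [[|[|//]] ?] [[|[|//]] ?].
case/injectivePn => p [q pq gpq].
have h a : g a = g p by case/orP: (two a a p q pq) => /eqP->.
by move=> a b; rewrite !h.
Qed.

(* With two points per block, the only maps available in a block are the identity and the
   constants, so a constant in a single block is irreducible. *)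
Lemma const_mem_genset (U : {set trans ('I_m * 'I_2)%type}) i c :
  mon_gen U = S -> at_block i (const_trans c) \in U.
Proof.
move=> US; set x := at_block i (const_trans c).
have xS : x \in S.
  by apply: mem_mon_gen; apply: at_block_idems; apply/ffunP => a; rewrite !ffunE.
have x_fst p : (x p).1 = p.1 by case: p => k a; rewrite wreathE trans_oneE.
have x1 : x != 1.
  apply/eqP => x1; have : x (i, ord0) = x (i, ord_max) by rewrite !wreathE eqxx !ffunE.
  by rewrite x1 !trans_oneE.
(* If [x] were not a generator, all generators would lie in S without [x]; that set is shown to be a
   submonoid, hence all of S. *)
apply: contraT => xU; suff /subsetP/(_ x) : S \subset S :\ x.
  by rewrite xS !inE eqxx => /(_ isT).
rewrite -{1}US; apply: mon_gen_subset; last first.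
  apply/subsetP => u uU; rewrite !inE -US mem_mon_gen // andbT.
  by apply: contraNneq xU => <-.
apply/submonoidP; split; first by rewrite !inE eq_sym x1 mon_gen1.
move=> y z; rewrite !inE => /andP[yx yS] /andP[zx zS]; rewrite mon_genM // andbT.
apply/eqP => yzx; pose o : 'I_2 := ord0.
have yP := S_TXP (isT : 0 < 2) yS; have zP := S_TXP (isT : 0 < 2) zS.
have bx : bar o x = 1 by rewrite bar_wreath.
have yzI : injective (bar o y * bar o z).
  by rewrite -bar_mul // yzx bx => p q; rewrite !trans_oneE.
have [y1 yc] := S_units yS (trans_inj_mulr yzI).
move: yzI; rewrite y1 mul1g => /(S_units zS)[z1 zc].
have yzc k : fiber k y * fiber k z = if k == i then const_trans c else 1.
  rewrite -(fiber_wreath (fun k => if k == i then const_trans c else 1) 1 k) -/(at_block _ _) -/x -yzx.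
  by rewrite {2}(TXP_wreath o yP) {2}(TXP_wreath o zP) wreathM fiber_wreath y1 trans_oneE.
have out k : k != i -> fiber k y = 1 /\ fiber k z = 1.
  move=> ki; have := yzc k; rewrite (negPf ki) => yz1.
  have yk : fiber k y = 1.
    by apply: yc; apply: (@trans_inj_mulr _ _ (fiber k z)); rewrite yz1 => p q; rewrite !trans_oneE.
  by move: yz1; rewrite yk mul1g.
have := yzc i; rewrite eqxx => yzi.
(* In block i, [z] is either 1, which makes y = x, or constant, necessarily with value [c], which
   makes z = x. *)
have [zI|zN] := boolP (injectiveb (fiber i z)).
  case/eqP: yx; rewrite (TXP_wreath o yP) y1; apply: eq_wreath => k.
  case: (k =P i) => [->|/eqP/out[]//].
  by move: yzi; rewrite (zc i) ?mulg1 //; apply/injectiveP.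
case/eqP: zx; rewrite (TXP_wreath o zP) z1; apply: eq_wreath => k.
case: (k =P i) => [->|/eqP/out[]//].
apply/ffunP => a; rewrite [RHS]ffunE -(ffunE (fun=> c) a).
rewrite (not_inj_const zN a (fiber i y a)) -trans_mulE yzi.
by rewrite !ffunE.
Qed.

(** Both constants of a block have the same kernel, so counting kernels gives only m generators
    here; irreducibility gives 2m. *)
Lemma card_non_merges2 (U : {set trans ('I_m * 'I_2)%type}) : mon_gen U = S ->
  m * 2 <= #|[set u in U | ~~ merges u]|.
Proof.
move=> US; pose D := [set: 'I_m * 'I_2].
have -> : (m * 2 = #|D|)%N by rewrite cardsT card_prod !card_ord.
apply: (leq_card_witness (P := fun t u => u == at_block t.1 (const_trans t.2))) => [[i c] _|].
  exists (at_block i (const_trans c)); split=> //; rewrite inE const_mem_genset //=.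
  apply/existsP => -[[p a] /existsP[[q b] /= /andP[pq]]].
  by rewrite !wreathE !trans_oneE => /eqP[e _]; rewrite e eqxx in pq.
move=> [i c] [i' c'] u _ _ /eqP-> /eqP /= /ffunP e.
have := e (i, ord0); have := e (i, ord_max); rewrite !wreathE eqxx !ffunE.
case: (i =P i') => [->|_]; first by rewrite !ffunE => -[->].
by rewrite !trans_oneE => -[->].
Qed.

End TwoPoints.

(** * Sizes of generating sets, and the ranks *)

Lemma card_genset m n (U : {set trans ('I_m * 'I_n)%type}) : 2 <= n ->
  mon_gen U = mon_gen (idems (TXP m n)) -> m * rho n + n`! * 'C(m, 2) <= #|U|.
Proof.
move=> n2 US; have n0 : 0 < n by apply: leq_trans n2.
have -> : #|U| = #|[set u in U | ~~ merges u]| + #|[set u in U | merges u]|.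
  rewrite -(cardsID [set u | merges u] U) addnC; congr (_ + _); apply: eq_card => u.
    by rewrite !inE andbC.
  by rewrite !inE.
apply: leq_add; last exact: card_merges.
rewrite /rho; case: eqP => [n2E|_]; last exact: card_non_merges.
by subst n; apply: card_non_merges2.
Qed.

Theorem theorem4p7 (m n : nat) (hm : 2 <= m) (hn : 2 <= n) :
  let S := mon_gen (idems (TXP m n)) in
  (forall (U : 'I_m -> {set trans 'I_n}) (V : {set trans 'I_m})
          (A B : 'I_m -> 'I_m -> {set 'S_n}),
     (forall i, min_idgenset (idgen_trans n) (U i)) ->
     V \subset idems (defect1 m) ->
     sing_trans m = sgp_gen V ->
     (forall i j, (i, j) \in Xi V ->
        [/\ A i j != set0, B i j != set0,
            A i j :|: B i j = setT & [disjoint A i j & B i j]]) ->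
     let G := (\bigcup_(i < m) [set at_block i g | g in U i]) :|: Wset V A B in
     idgenset S G /\ #|G| = m * rho n + n`! * 'C(m, 2)) /\
  rank S = m * rho n + n`! * 'C(m, 2) /\
  idrank S = m * rho n + n`! * 'C(m, 2).
Proof.
move=> S; have n0 : 0 < n by apply: leq_trans hn.
have m0 : 0 < m by apply: leq_trans hm.
have main (U : 'I_m -> {set trans 'I_n}) (V : {set trans 'I_m})
    (A B : 'I_m -> 'I_m -> {set 'S_n}) :
    (forall i, min_idgenset (idgen_trans n) (U i)) ->
    V \subset idems (defect1 m) -> sing_trans m = sgp_gen V ->
    (forall i j, (i, j) \in Xi V ->
       [/\ A i j != set0, B i j != set0,
           A i j :|: B i j = setT & [disjoint A i j & B i j]]) ->
    let G := (\bigcup_(i < m) [set at_block i g | g in U i]) :|: Wset V A B in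
    idgenset S G /\ #|G| = m * rho n + n`! * 'C(m, 2).
  move=> hU hV sV hAB G.
  have GS : idgenset S G.
    have hH := mon_gen_submonoid G; apply: idgensetE.
      apply/subsetP => x; case/setUP => [/bigcupP[i _ /imsetP[g gU ->]]|].
        have [/andP[/subsetP/(_ g gU)]] := hU i; rewrite inE => /andP[_ /eqP gg] _ _.
        exact: at_block_idems.
      by case/WsetP => i [j [f [ij ->]]]; apply: e_perm_idems.
    apply: idems_TXP_sub => // [i g|h al].
      have [/andP[_ /eqP <-] _] := hU i.
      apply: (mon_gen_hom hH (at_block1 _ i)) => [x y|u uU]; first exact: at_blockM.
      by apply/mem_mon_gen/setUP; left; apply/bigcupP; exists i => //; apply: imset_f.
    rewrite sV; apply: twisted_gen => // {}al alV.
    have [i [j [ij alE]]] := idem_defect1P m0 (subsetP hV _ alV).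
    (* For al = [e_ i j] the twisted label at j is this one, and every other label is h_k^-1 h_k =
       1. *)
    have : e_perm i j ((h j)^-1 * h i)%g \in mon_gen G.
      apply: (Wset_gen_e_perm (V := V) (A := A) (B := B)) => //; last by rewrite -alE.
        by apply: subset_trans (sub_mon_gen _); apply: subsetUr.
      by move=> k l /hAB[].
    rewrite alE /e_perm; apply: eq_wreath_in => k; rewrite e_E.
    case: (k =P j) => [->//|_].
    by rewrite mulVg trans_of_perm1.
  (* The bound [card_genset] for generating sets gives one inequality, the union bound the other; by
     minimality each [U i] has at most [rho n] elements. *)
  split=> //; apply/eqP; rewrite eqn_leq; apply/andP; split; last first.
    by apply: card_genset => //; case/andP: GS => _ /eqP.
  apply: leq_trans (leq_card_setU _ _).1 _; apply: leq_add; last first.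
    by apply: card_Wset => i j /hAB[].
  have [U0 [U0g U0c]] := idgen_trans_small hn.
  rewrite -[X in (_ <= X * _)%N]card_ord -sum_nat_const.
  apply: leq_trans (_ : \sum_(i < m) #|[set at_block i g | g in U i]| <= _).
    elim/big_rec2: _ => [|i k C _ le]; first by rewrite cards0.
    by apply: leq_trans (leq_card_setU _ _).1 _; rewrite leq_add2l.
  apply: leq_sum => i _; apply: leq_trans (leq_imset_card _ _) _.
  by apply: leq_trans U0c; have [_ ->] := hU i.
split=> //.
have [U0 [U0g U0c]] := idgen_trans_small hn.
have [U1 hU1] : exists U1, min_idgenset (idgen_trans n) U1.
  case: (arg_minnP (fun U : {set trans 'I_n} => #|U|) U0g) => U1 U1g U1m.
  by exists U1; split.
(* A concrete partition of S_n; the complement of 1 is non-empty because n! >= 2. *)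
pose A (i j : 'I_m) : {set 'S_n} := [set 1%g].
pose B (i j : 'I_m) : {set 'S_n} := [set~ 1%g].
have [|G_id cG] := main (fun=> U1) (idems (defect1 m)) A B (fun=> hU1) (subxx _) (sing_gen_defect1 m0).
  move=> i j _; split.
  - by apply/set0Pn; exists 1%g; rewrite inE.
  - rewrite -card_gt0 cardsC1 card_Sn -ltnS prednK ?fact_gt0 //.
    exact: leq_trans hn (fact_geq n).
  - by apply/setP => f; rewrite !inE; case: eqP.
  - by rewrite disjoints1 !inE eqxx.
(* The set from [main] bounds both ranks above, and [card_genset] applied to a minimizer bounds them
   below. The first goal left by [arg_minnP] is that the default of the [arg min] generates. *)
rewrite -cG; split; apply/eqP; rewrite eqn_leq; apply/andP; split.
- exact: rank_genset (idgenset_genset G_id).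
- rewrite cG /rank; case: arg_minnP => [|U Ug _]; first exact: genset_mon_gen.
  by apply: card_genset => //; case/andP: Ug => _ /eqP.
- rewrite /idrank; case: arg_minnP => [|U _ ->] //; exact: idgenset_idems.
- rewrite cG /idrank; case: arg_minnP => [|U /idgenset_genset Ug _]; first exact: idgenset_idems.
  by apply: card_genset => //; case/andP: Ug => _ /eqP.
Qed.
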